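(* Let $f:[0,\infty)\to[0,\infty)$ be $2$-radical convex, let $a<b$ be real numbers, and let $g:[a,b]\to[0,\infty)$ be continuous. Then $$f\left(\frac{1}{b-a}\int_a^b g(y)\,dy\right)\le \frac{1}{b-a}\int_a^b\left\{f\left(\frac{g(x)+\frac{1}{b-a}\int_a^b g(y)\,dy}{2}\right)+f\left(\frac{\left|g(x)-\frac{1}{b-a}\int_a^b g(y)\,dy\right|}{2}\right)\right\}dx\le \frac{1}{b-a}\int_a^b f(g(x))\,dx.$$
   Context: Let $p\ge 1$. A continuous function $f:[0,\infty)\to[0,\infty)$ with $f(0)=0$ is called $p$-radical convex if the function $x\mapsto f\left(x^{1/p}\right)$ is convex on $[0,\infty)$. In particular $f$ is $2$-radical convex if $x\mapsto f(\sqrt{x})$ is convex on $[0,\infty)$. *)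

(* Defs.v *)
From HB Require Import structures.
From mathcomp Require Import all_boot all_order all_algebra.
From mathcomp Require Import all_classical all_reals all_analysis.

Set Implicit Arguments.
Unset Strict Implicit.
Unset Printing Implicit Defensive.

Import Order.TTheory GRing.Theory Num.Theory.
Import numFieldNormedType.Exports.

Local Open Scope classical_set_scope.
Local Open Scope ring_scope.

(* A function [0, +oo[ -> [0, +oo[ is encoded as f : R -> R mapping [0, +oo[ to
   itself; the values of f at negative reals are unconstrained and unused. *)
Definition radical_convex (R : realType) (p : R) (f : R -> R) : Prop :=
  [/\ 1 <= p,
      {homo f : x / 0 <= x},
      {within `[0, +oo[, continuous f},
      f 0 = 0 &
      convex_function (`[0, +oo[%classic : set R)
                      (fun x : R => f (x `^ p^-1) : R^o)].

(* For f continuous on [a, b], the Lebesgue integral below is the Riemann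
   integral of f from a to b. *)
Definition average (R : realType) (a b : R) (f : R -> R) : R :=
  (b - a)^-1 * \int[@lebesgue_measure R]_(x in `[a, b]) f x.

(* Main.v *)
(** Write f(y) = h(y^2) with h convex on [0, +oo[, h(0) = 0 and h >= 0, let m be
    the average of g, and put A = (g + m)/2 and B = |g - m|/2.  A supporting
    line of h at m^2 has slope c >= 0, so that f(y) >= f(m) + 2cm(y - m), and
    Jensen's inequality at m follows for every average-m function.  As A has
    average m, averaging f(A) + f(B) >= f(A) gives the first inequality.  For
    the second one, A^2 + B^2 = (g^2 + m^2)/2, and superadditivity and convexity
    of h give f(A) + f(B) <= (f(g) + f(m))/2; average, and bound f(m) by the
    average of f(g) by Jensen's inequality once more. *)
Require Import Defs.
From HB Require Import structures.
From mathcomp Require Import all_boot all_order all_algebra.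
From mathcomp Require Import ring lra.
From mathcomp Require Import all_classical all_reals all_analysis.

Set Implicit Arguments.
Unset Strict Implicit.
Unset Printing Implicit Defensive.

Import Order.TTheory GRing.Theory Num.Theory.
Import numFieldNormedType.Exports.

Local Open Scope classical_set_scope.
Local Open Scope ring_scope.

(** Since [g] maps [A] into [B], points of [A] close to [x] go to points of [B] close to [g x],
    where continuity of [f] within [B] applies. It serves for [f] continuous on the half-line [[0,
    +oo[]. *)
Lemma within_continuous_comp_homo (S T U : topologicalType) (A : set S)
    (B : set T) (f : T -> U) (g : S -> T) :
  {homo g : x / A x >-> B x} ->
  {within B, continuous f} -> {within A, continuous g} ->
  {within A, continuous (f \o g)}.
Proof.
move=> gAB /subspace_continuousP fB /subspace_continuousP gA.
apply/subspace_continuousP => x Ax P /(fB _ (gAB _ Ax)) nP.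
have := gA _ Ax _ nP; rewrite !nbhs_simpl/= /within/=.
apply: filterS => z /= + Az; apply => //; exact: gAB.
Qed.

Lemma average_ge0 (R : realType) (a b : R) (f : R -> R) : a < b ->
  {in `[a, b], forall x, 0 <= f x} -> 0 <= average a b f.
Proof.
move=> ab f0; apply: mulr_ge0; first by rewrite invr_ge0 subr_ge0 ltW.
by apply: Rintegral_ge0 => x; exact: f0.
Qed.

Section average_continuous.
Variables (R : realType) (a b : R).
Hypothesis ltab : a < b.
Implicit Types (f g : R -> R) (k : R).

Let mu := @lebesgue_measure R.

Let integrable_itvcc f : {within `[a, b], continuous f} ->
  mu.-integrable `[a, b] (EFin \o f).
Proof.
by move=> cf; apply: continuous_compact_integrable => //; exact: segment_compact.
Qed.

Lemma average_cst k : average a b (fun=> k) = k.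
Proof.
rewrite /average Rintegral_cst//= lebesgue_measure_itv/= lte_fin ltab/=.
by field; rewrite subr_eq0 gt_eqF.
Qed.

Lemma averageD f g :
  {within `[a, b], continuous f} -> {within `[a, b], continuous g} ->
  average a b (fun x => f x + g x) = average a b f + average a b g.
Proof.
move=> cf cg; rewrite /average RintegralD ?mulrDr//; exact: integrable_itvcc.
Qed.

Lemma averageZ k f : {within `[a, b], continuous f} ->
  average a b (fun x => k * f x) = k * average a b f.
Proof.
move=> cf; rewrite /average RintegralZl//; [exact: mulrCA|exact: integrable_itvcc].
Qed.

Lemma le_average f g :
  {within `[a, b], continuous f} -> {within `[a, b], continuous g} ->
  {in `[a, b], forall x, f x <= g x} -> average a b f <= average a b g.
Proof.
move=> cf cg fg; rewrite /average ler_pM2l ?invr_gt0 ?subr_gt0//.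
by apply: le_Rintegral => //; exact: integrable_itvcc.
Qed.

Lemma within_continuous_affine k l f : {within `[a, b], continuous f} ->
  {within `[a, b], continuous (fun x => k + l * f x)}.
Proof.
move=> cf x; apply: cvgD; first exact: cvg_cst.
by apply: cvgM; [exact: cvg_cst|exact: cf].
Qed.

Lemma average_affine k l f : {within `[a, b], continuous f} ->
  average a b (fun x => k + l * f x) = k + l * average a b f.
Proof.
move=> cf; rewrite averageD ?average_cst ?averageZ//.
- by move=> x; exact: cvg_cst.
- by move=> x; apply: cvgM; [exact: cvg_cst|exact: cf].
Qed.

(** Convexity enters through a line of slope [c] supporting [f] at the average [m] of [g]: its
    composite with [g] is a minorant of [f \o g] with average [f m], because [g - m] averages to
    zero. *)
Lemma jensen_average f g (c : R) :
  {within `[a, b], continuous g} -> {within `[a, b], continuous (f \o g)} ->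
  {in `[a, b], forall x,
     f (average a b g) + c * (g x - average a b g) <= f (g x)} ->
  f (average a b g) <= average a b (f \o g).
Proof.
move=> cg cfg; set m := average a b g => supp.
have -> : f m = average a b (fun x => (f m - c * m) + c * g x).
  by rewrite average_affine// -/m subrK.
apply: le_average => //; first exact: within_continuous_affine.
by move=> x /supp; apply: le_trans; rewrite mulrBr addrAC addrA.
Qed.

End average_continuous.

Section convex_nonneg_half_line.
Variables (R : realType) (h : R -> R).
Hypothesis h_convex :
  convex_function (`[0, +oo[%classic : set R) (h : R -> R^o).

Lemma convex_half_lineE (t x y : R) : 0 <= t <= 1 -> 0 <= x -> 0 <= y ->
  h (t * x + (1 - t) * y) <= t * h x + (1 - t) * h y.
Proof.
move=> /andP[t0 t1] x0 y0.
have := h_convex (Itv01 t0 t1) (x := x) (y := y).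
by rewrite !inE/= !in_itv/= !andbT x0 y0 => /(_ isT isT).
Qed.

(** The point [x] is the barycentre of [s] and [u] with weights [(u - x) / (u - s)] and
    [(x - s) / (u - s)]; denominators are cleared so that slopes compare linearly. *)
Lemma convex_chord (s x u : R) : 0 <= s -> s < x -> x < u ->
  (u - s) * h x <= (u - x) * h s + (x - s) * h u.
Proof.
move=> s0 sx xu; have us : 0 < u - s by lra.
have [u0 u1] : 0 <= u /\ u - s != 0 by rewrite gt_eqF//; split => //; lra.
have t01 : 0 <= (u - x) / (u - s) <= 1.
  by rewrite divr_ge0 ?ler_pdivrMr//; lra.
have := convex_half_lineE t01 s0 u0.
rewrite (_ : _ * s + _ = x); last by field.
rewrite -(ler_pM2l us) => /le_trans; apply.
by rewrite le_eqVlt; apply/orP; left; apply/eqP; field.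
Qed.

(** Each [z] in [[0, x + y]] is a convex combination of [x + y] and [0], so [h z] lies below the
    chord from the origin; the weights of [x] and [y] add up to 1. *)
Lemma convex_superadditive (x y : R) : h 0 = 0 -> 0 <= x -> 0 <= y ->
  h x + h y <= h (x + y).
Proof.
move=> h0 x0 y0; have [xy0|xy0] := eqVneq (x + y) 0.
  have [-> ->] : x = 0 /\ y = 0 by split; lra.
  by rewrite addr0 h0 addr0.
have xy_gt0 : 0 < x + y by rewrite lt_def xy0 addr_ge0.
have scale (z : R) : 0 <= z <= x + y -> h z <= z / (x + y) * h (x + y).
  move=> /andP[z0 zxy].
  have t01 : 0 <= z / (x + y) <= 1.
    by rewrite divr_ge0 ?(ltW xy_gt0)//= ler_pdivrMr// mul1r.
  have := convex_half_lineE t01 (ltW xy_gt0) (lexx 0).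
  by rewrite !mulr0 h0 mulr0 !addr0 divfK.
have hx : h x <= _ := scale x ltac:(lra).
have hy : h y <= _ := scale y ltac:(lra).
apply: le_trans (lerD hx hy) _.
by rewrite -mulrDl -mulrDl divff// mul1r.
Qed.

Hypotheses (h0 : h 0 = 0) (h_ge0 : forall x, 0 <= x -> 0 <= h x).

(* The slope is the supremum of the chord slopes to the left of [x], which
   include the slope [h x / x >= 0] of the chord from the origin. *)
Lemma convex_support (x : R) : 0 <= x ->
  exists2 c : R, 0 <= c & forall t, 0 <= t -> h x + c * (t - x) <= h t.
Proof.
rewrite le_eqVlt => /predU1P[<-|x0].
  (* At the endpoint 0 there is no chord to the left, but [h] is minimal there, so slope 0 works. *)
  by exists 0 => // t t0; rewrite h0 mul0r addr0 h_ge0.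
pose slope (s : R) : R := (h x - h s) / (x - s).
pose E := [set slope s | s in `[0, x[].
(* Chord slopes to the right of [x] dominate those to the left: this makes the supremum finite and
   later gives the support inequality for [t > x]. *)
have ubE u : x < u -> ubound E ((h u - h x) / (u - x)).
  move=> xu _ [s + <-]; rewrite /= in_itv/= => /andP[s0 sx].
  rewrite /slope ler_pdivrMr ?subr_gt0// mulrAC ler_pdivlMr ?subr_gt0//.
  have := convex_chord s0 sx xu; lra.
have E0 : E (slope 0) by exists 0 => //=; rewrite in_itv/= lexx.
have supE : has_sup E.
  split; first by exists (slope 0).
  by eexists; apply: (ubE (x + 1)); rewrite ltrDl.
exists (sup E) => [|t t0].
  apply: le_trans (sup_upper_bound supE E0).
  by rewrite /slope h0 !subr0 divr_ge0 ?h_ge0 ?ltW.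
have [tx|xt|->] := ltgtP t x; last by rewrite subrr mulr0 addr0.
- have : slope t <= sup E.
    by apply: (sup_upper_bound supE); exists t => //=; rewrite in_itv/= t0.
  by rewrite /slope ler_pdivrMr ?subr_gt0//; lra.
- have : sup E <= (h t - h x) / (t - x).
    by apply: ge_sup; [exists (slope 0)|exact: ubE].
  by rewrite ler_pdivlMr ?subr_gt0//; lra.
Qed.

End convex_nonneg_half_line.

Section radical_convex2.
Variables (R : realType) (f : R -> R).
Hypothesis f_rconvex : radical_convex 2 f.

Let h (x : R) : R := f (x `^ 2^-1).

Let h_convex : convex_function (`[0, +oo[%classic : set R) (h : R -> R^o).
Proof. by case: f_rconvex. Qed.

Let h0 : h 0 = 0.
Proof. by case: f_rconvex => _ _ _ f0 _; rewrite /h powR0 ?invr_eq0. Qed.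

Let h_ge0 x : 0 <= x -> 0 <= h x.
Proof. by case: f_rconvex => _ f_ge0 _ _ _ _; rewrite f_ge0 ?powR_ge0. Qed.

Let h_sqr x : 0 <= x -> h (x ^+ 2) = f x.
Proof. by move=> x0; rewrite /h powR12_sqrt ?sqr_ge0// sqrtr_sqr ger0_norm. Qed.

(** Pulled back along squaring, the line of slope [c >= 0] supporting [h] at [m ^+ 2] becomes a
    parabola; its tangent at [m] has slope [2 * m * c] and lies below it by [c * (y - m) ^+ 2]. *)
Lemma radical_convex2_support (m : R) : 0 <= m ->
  exists c, forall y, 0 <= y -> f m + c * (y - m) <= f y.
Proof.
move=> m0; have [c c0 supp] := convex_support h_convex h0 h_ge0 (sqr_ge0 m).
exists (2 * m * c) => y y0; rewrite -(h_sqr m0) -(h_sqr y0).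
apply: le_trans (supp _ (sqr_ge0 y)); rewrite lerD2l -subr_ge0.
have -> : c * (y ^+ 2 - m ^+ 2) - 2 * m * c * (y - m) = c * (y - m) ^+ 2.
  by ring.
by rewrite mulr_ge0 ?sqr_ge0.
Qed.

Lemma radical_convex2_midpoint (u m : R) : 0 <= u -> 0 <= m ->
  f ((u + m) / 2) + f (`|u - m| / 2) <= 2^-1 * f m + 2^-1 * f u.
Proof.
move=> u0 m0.
rewrite -(h_sqr u0) -(h_sqr m0) -[f (_ / 2)]h_sqr ?divr_ge0 ?addr_ge0//.
rewrite -[f (`|_| / 2)]h_sqr ?divr_ge0//.
apply: le_trans (convex_superadditive h_convex h0 (sqr_ge0 _) (sqr_ge0 _)) _.
(* By the parallelogram identity the two squares add up to the midpoint of [m ^+ 2] and [u ^+ 2]. *)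
rewrite [X in h X <= _](_ : _ = 2^-1 * m ^+ 2 + (1 - 2^-1) * u ^+ 2); last first.
  by rewrite (expr_div_n `|_|) real_normK ?num_real//; field.
rewrite [X in _ <= _ + X * _](_ : _ = 1 - 2^-1); last by field.
by apply: (convex_half_lineE h_convex); rewrite ?sqr_ge0//; lra.
Qed.

End radical_convex2.

Theorem corollary2p5 (R : realType) (f g : R -> R) (a b : R)
    (f_rconvex : radical_convex 2 f) (ltab : a < b)
    (g_ge0 : forall x, x \in `[a, b] -> 0 <= g x)
    (g_cont : {within `[a, b], continuous g}) :
  f (average a b g) <=
    average a b (fun x => f ((g x + average a b g) / 2)
                          + f (`|g x - average a b g| / 2)) /\
  average a b (fun x => f ((g x + average a b g) / 2)
                        + f (`|g x - average a b g| / 2)) <=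
    average a b (fun x => f (g x)).
Proof.
have m0 : 0 <= average a b g by exact: average_ge0.
have [c supp] := radical_convex2_support f_rconvex m0.
have [_ f_ge0 f_cont _ _] := f_rconvex.
set m := average a b g in m0 supp *.
have f_comp (u : R -> R) : {within `[a, b], continuous u} ->
    {in `[a, b], forall x, 0 <= u x} -> {within `[a, b], continuous (f \o u)}.
  move=> cu u0; apply: within_continuous_comp_homo f_cont cu => x /= /u0.
  by rewrite in_itv/= andbT.
(* The affine form gives access to the lemmas on affine images of [g]. *)
pose A x := m / 2 + 2^-1 * g x.
have AE x : (g x + m) / 2 = A x by rewrite /A; field.
have cA : {within `[a, b], continuous A} by exact: within_continuous_affine.
have A0 : {in `[a, b], forall x, 0 <= A x}.
  by move=> x /g_ge0 gx; rewrite -AE divr_ge0 ?addr_ge0.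
have cB : {within `[a, b], continuous (fun x => `|g x - m| / 2)}.
  move=> x; apply: cvgM; last exact: cvg_cst.
  by apply: cvg_norm; apply: cvgB; [exact: g_cont|exact: cvg_cst].
have avgA : average a b A = m.
  by rewrite average_affine// -/m; field.
have cfA := f_comp _ cA A0.
have cfB := f_comp _ cB (fun x _ => divr_ge0 (normr_ge0 _) (ler0n _ 2)).
have cfg := f_comp _ g_cont g_ge0.
have fA : f m <= average a b (f \o A).
  (* [A] and [g] share the average [m], so one supporting slope [c] serves both. *)
  rewrite -{1}avgA; apply: (@jensen_average _ _ _ _ _ _ c) => //.
  by move=> x /A0 /supp; rewrite avgA.
have fg : f m <= average a b (f \o g).
  by apply: (@jensen_average _ _ _ _ _ _ c) => // x /g_ge0 /supp.
have -> : (fun x => f ((g x + m) / 2) + f (`|g x - m| / 2)) =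
          (fun x => (f \o A) x + f (`|g x - m| / 2)).
  by apply/funext => x; rewrite AE.
split.
  (* The second summand has a nonnegative average and is dropped. *)
  rewrite averageD//; apply: (le_trans fA); rewrite lerDl.
  by apply: average_ge0 => // x _; rewrite f_ge0 ?divr_ge0.
(* This is the average of the pointwise midpoint bound; [fg] then absorbs [f m]. *)
apply: (@le_trans _ _ (2^-1 * f m + 2^-1 * average a b (f \o g))).
  rewrite -average_affine//; apply: le_average => //.
  - by move=> x; apply: cvgD; [exact: cfA|exact: cfB].
  - exact: within_continuous_affine.
  - by move=> x /g_ge0 gx; rewrite /= -AE; exact: radical_convex2_midpoint.
by move: fg; rewrite /comp; lra.
Qed.
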